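(* Let $S$ be an ordered semigroup. Then $S$ is a nil extension of a group like ordered semigroup if and only if for all $a, b \in S$ there exists $n \in \mathbb{N}$ such that $a^{n} \in (b^{n}Sb^{n}]$.
   Context: $\mathbb{N}$ is the set of natural numbers (positive integers). An ordered semigroup $(S,\cdot,\leq)$ is a (nonempty) partially ordered set $(S,\leq)$ together with a semigroup structure $(S,\cdot)$ such that for all $a,b,x \in S$, $a \leq b$ implies $xa \leq xb$ and $ax \leq bx$. For $H \subseteq S$, $(H] = \{t \in S : t \leq h \text{ for some } h \in H\}$. For elements $u,v \in S$, $uSv = \{usv : s \in S\}$. A nonempty subset $I \subseteq S$ is an ideal of $S$ if $SI \subseteq I$, $IS \subseteq I$ and $(I] = I$. $S$ is a nil extension of an ideal $I$ if the Rees factor ordered semigroup $S/I$ is nil (every element has some power equal to zero); equivalently, for every $a \in S$ there exists $m \in \mathbb{N}$ with $a^m \in I$. ''$S$ is a nil extension of a group like ordered semigroup'' means that there is an ideal $K$ of $S$ such that $S$ is a nil extension of $K$ and $K$, with the restricted operation and order, is a group like ordered semigroup. An ordered semigroup $K$ is group like if for all $a, b \in K$ there are $x, y \in K$ such that $a \leq xb$ and $a \leq by$. *)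

(* Defs.v *)
From HB Require Import structures.
From mathcomp Require Import all_boot all_order.
From mathcomp Require Import boolp classical_sets.

Set Implicit Arguments.
Unset Strict Implicit.
Unset Printing Implicit Defensive.

Import Order.TTheory.

Local Open Scope classical_set_scope.
Local Open Scope group_scope.

HB.mixin Record isOrderedSemigroup d S of Semigroup S & Order.POrder d S := {
  osg_inhabited : inhabited S;
  le_mulg2l : forall x a b : S, (a <= b)%O -> (x * a <= x * b)%O;
  le_mulg2r : forall x a b : S, (a <= b)%O -> (a * x <= b * x)%O
}.

#[short(type="osemigroupType")]
HB.structure Definition OrderedSemigroup d :=
  { S of isOrderedSemigroup d S & Semigroup S & Order.POrder d S }.

(* Powers in a semigroup, meaningful for positive exponents only (there is no
   unit, so the library's [natexp] is unavailable): [spow x 0 = x] is junk. *)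
Definition spow (S : semigroupType) (x : S) (n : nat) : S := iterop n *%g x x.

Section Sets.
Context d (S : osemigroupType d).
Implicit Types A B : set S.

Definition setmul A B : set S := [set x * y | x in A & y in B].

(* u S v *)
Definition sandwich (u v : S) : set S := [set u * s * v | s in setT].

Record ideal := Ideal {
  ideal_set :> set S;
  ideal_neq0 : ideal_set !=set0;
  ideal_mull : setmul setT ideal_set `<=` ideal_set;
  ideal_mulr : setmul ideal_set setT `<=` ideal_set;
  ideal_down : down ideal_set = ideal_set
}.

End Sets.
Arguments setmul {d S}.
Arguments sandwich {d S}.

(* An ideal as an ordered semigroup, with the restricted product and order. *)
Definition ideal_type d (S : osemigroupType d) (K : ideal S) : Type :=
  {x : S | x \in (K : set S)}.

Section IdealType.
Context d (S : osemigroupType d) (K : ideal S).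

Fact ideal_mulg_closed : mulg_closed [in (K : set S)].
Proof.
move=> x y /set_mem Kx /set_mem Ky; apply/mem_set.
by apply: (@ideal_mulr _ _ K); exists x => //; exists y.
Qed.

HB.instance Definition _ := SubChoice.on (ideal_type K).
HB.instance Definition _ := [SubChoice_isSubPOrder of ideal_type K by <: with d].
HB.instance Definition _ :=
  SubChoice_isSubSemigroup.Build S _ (ideal_type K) ideal_mulg_closed.

Fact ideal_type_inhabited : inhabited (ideal_type K).
Proof. by have [x Kx] := ideal_neq0 K; constructor; exists x; apply/mem_set. Qed.

Fact ideal_type_mul2l (x a b : ideal_type K) :
  (a <= b)%O -> (x * a <= x * b)%O.
Proof. by rewrite -!Order.le_val !valM; apply: le_mulg2l. Qed.

Fact ideal_type_mul2r (x a b : ideal_type K) :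
  (a <= b)%O -> (a * x <= b * x)%O.
Proof. by rewrite -!Order.le_val !valM; apply: le_mulg2r. Qed.

HB.instance Definition _ := isOrderedSemigroup.Build d (ideal_type K)
  ideal_type_inhabited ideal_type_mul2l ideal_type_mul2r.

End IdealType.

(* The Rees factor ordered semigroup S/I: the elements outside I together with
   a zero [None], which is below every element. *)
Definition rees d (S : osemigroupType d) (I : ideal S) : Type :=
  option {x : S | x \notin (I : set S)}.

Section Rees.
Context d (S : osemigroupType d) (I : ideal S).
Implicit Types u v w : rees I.

HB.instance Definition _ := Choice.on (rees I).

Definition rees_mul u v : rees I :=
  if (u, v) is (Some x, Some y) then insub (val x * val y) else None.

Definition rees_le u v : bool :=
  match u, v with
  | None, _ => true
  | Some x, Some y => (val x <= val y)%O
  | Some _, None => false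
  end.

Fact ideal_memMl (x y : S) : y \in (I : set S) -> x * y \in (I : set S).
Proof.
move=> /set_mem Iy; apply/mem_set.
by apply: (@ideal_mull _ _ I); exists x => //; exists y.
Qed.

Fact ideal_memMr (x y : S) : x \in (I : set S) -> x * y \in (I : set S).
Proof.
move=> /set_mem Ix; apply/mem_set.
by apply: (@ideal_mulr _ _ I); exists x => //; exists y.
Qed.

Fact ideal_mem_le (x y : S) :
  (x <= y)%O -> y \in (I : set S) -> x \in (I : set S).
Proof.
by move=> xy /set_mem Iy; apply/mem_set; rewrite -(ideal_down I); exists y.
Qed.

Definition rees_class (x : S) : rees I := insub x.

Lemma rees_classP u : u = None \/ exists2 x, x \notin (I : set S) & u = rees_class x.
Proof.
case: u => [[x Ix]|]; [right; exists x => //|by left].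
by rewrite /rees_class insubT.
Qed.

Lemma rees_classE x : (rees_class x == None) = (x \in (I : set S)).
Proof. by rewrite /rees_class; case: insubP => [[z Iz] /negPf -> //|/negPn ->]. Qed.

Lemma rees_mul0 u : rees_mul u None = None.
Proof. by case: u. Qed.

Lemma rees_classM x y :
  rees_mul (rees_class x) (rees_class y) = rees_class (x * y).
Proof.
have class0 z : z \in (I : set S) -> rees_class z = None.
  by rewrite -rees_classE => /eqP.
have [Ix|Ix] := boolP (x \in (I : set S)).
  by rewrite (class0 x) ?(class0 (x * y)) ?ideal_memMr.
have [Iy|Iy] := boolP (y \in (I : set S)).
  by rewrite (class0 y) ?(class0 (x * y)) ?ideal_memMl ?rees_mul0.
rewrite {1 2}/rees_class.
rewrite (insubT (fun z => z \notin (I : set S)) Ix).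
by rewrite (insubT (fun z => z \notin (I : set S)) Iy).
Qed.

Fact rees_mulA : associative rees_mul.
Proof.
move=> u v w.
have [->|[x _ ->]] := rees_classP u; first by [].
have [->|[y _ ->]] := rees_classP v; first by rewrite /= rees_mul0.
have [->|[z _ ->]] := rees_classP w; first by rewrite !rees_mul0.
by rewrite !rees_classM mulgA.
Qed.

Fact rees_le_refl : reflexive rees_le.
Proof. by case=> //= x; apply: lexx. Qed.

Fact rees_le_anti : antisymmetric rees_le.
Proof. by case=> [x|] [y|] //= /le_anti /val_inj ->. Qed.

Fact rees_le_trans : transitive rees_le.
Proof. by case=> [y|] [x|] [z|] //=; apply: le_trans. Qed.

HB.instance Definition _ := isSemigroup.Build (rees I) rees_mulA.
HB.instance Definition _ := Order.Le_isPOrder.Build d (rees I)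
  rees_le_refl rees_le_anti rees_le_trans.

Lemma rees_class_le x y : (x <= y)%O -> rees_le (rees_class x) (rees_class y).
Proof.
move=> xy; rewrite /rees_class.
case: insubP => [[a Ia] _ /= ax|//]; case: insubP => [[b Ib] _ /= byy|].
  by rewrite /= ax byy.
by move=> /negPn /(ideal_mem_le xy); rewrite -ax (negPf Ia).
Qed.

Lemma rees_le_class u v : rees_le u v -> u = None \/
  exists x y, [/\ u = rees_class x, v = rees_class y & (x <= y)%O].
Proof.
case: u v => [[x Ix]|] [[y Iy]|] //= xy; [right|by left|by left].
by exists x, y; rewrite /rees_class !insubT.
Qed.

Fact rees_inhabited : inhabited (rees I).
Proof. by constructor; exact: None. Qed.

Fact rees_mul2l (w u v : rees I) : (u <= v)%O -> (w * u <= w * v)%O.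
Proof.
move=> /rees_le_class[->|[x [y [-> -> xy]]]]; first by case: w.
have [->//|[z _ ->]] := rees_classP w.
by rewrite /mul /= !rees_classM; apply/rees_class_le/le_mulg2l.
Qed.

Fact rees_mul2r (w u v : rees I) : (u <= v)%O -> (u * w <= v * w)%O.
Proof.
move=> /rees_le_class[->//|[x [y [-> -> xy]]]].
have [->|[z _ ->]] := rees_classP w; first by rewrite /mul /= !rees_mul0.
by rewrite /mul /= !rees_classM; apply/rees_class_le/le_mulg2r.
Qed.

HB.instance Definition _ := isOrderedSemigroup.Build d (rees I)
  rees_inhabited rees_mul2l rees_mul2r.

End Rees.

Definition is_zero d (S : osemigroupType d) (z : S) : Prop :=
  forall x : S, [/\ z * x = z, x * z = z & (z <= x)%O].

Definition is_nil d (S : osemigroupType d) : Prop :=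
  exists2 z : S, is_zero z & forall a : S, exists2 m, (0 < m)%N & spow a m = z.

Definition is_nil_extension d (S : osemigroupType d) (I : ideal S) : Prop :=
  is_nil (rees I).

Definition group_like d (K : osemigroupType d) : Prop :=
  forall a b : K, exists x y : K, (a <= x * b)%O /\ (a <= b * y)%O.

Definition nil_extension_of_group_like d (S : osemigroupType d) : Prop :=
  exists2 K : ideal S, is_nil_extension K & group_like (ideal_type K).

Lemma is_nil_extensionP d (S : osemigroupType d) (I : ideal S) :
  is_nil_extension I <->
  forall a : S, exists2 m, (0 < m)%N & (I : set S) (spow a m).
Proof.
have zN : is_zero (None : rees I).
  by move=> x; split; [|exact: rees_mul0|].
have pE (a : S) m : spow (rees_class I a) m = rees_class I (spow a m).
  case: m => // m; rewrite /spow !iteropS.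
  by elim: m => // m IH; rewrite !iterS IH [LHS]rees_classM.
split=> [[z zz nilz] a|nilI].
  have {zz} z0 : z = None by have [_ <- _] := zz None; have [] := zN z.
  have [m m0] := nilz (rees_class I a).
  by rewrite pE z0 => /eqP; rewrite rees_classE => /set_mem; exists m.
exists None => // u; have [->|[x _ ->]] := rees_classP u; first by exists 1%N.
have [m m0 /mem_set] := nilI x; rewrite -rees_classE => /eqP Im.
by exists m => //; rewrite pE.
Qed.

(* Main.v *)
Require Import Defs.
From mathcomp Require Import all_boot all_order.
From mathcomp Require Import boolp classical_sets.

(** The ideal behind a nil extension of a group like ordered semigroup is the
    least ideal, that is, the kernel: the set of the elements lying in
    [(S b S]] for every [b].

    If [S] is a nil extension of a group like [K], some common exponent [n]
    puts both [a ^ n] and [b ^ n] in [K]; solving [a ^ n <= b ^ n * y] and then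
    [y <= x * b ^ n] inside [K] gives [a ^ n <= b ^ n * x * b ^ n].

    Conversely, comparing [a] with [a * a] yields an [n] such that [c = a ^ n]
    satisfies [c <= c * c * r]. Such a [c] absorbs all its powers,
    [c <= c ^ k * t] for every [k] ([le_spow_mul]); as some [c ^ k] lies in
    [(S b S]], so does [c]. So every element has a power in the kernel
    ([kernel_spow]), which is therefore nonempty and an ideal. The kernel is
    group like because an [a] in it satisfies [a <= u * (a * a * a) * v], an
    inequality of the form [a <= p * a * q]. Iterated, it gives
    [a <= p ^ n * a * q ^ n] ([le_spow_sandwich]), and for any
    prescribed [b] the condition puts a power of [q] below a left multiple of
    [b], and a power of [p] below a right multiple ([kernel_divl],
    [kernel_divr]). *)

Set Implicit Arguments.
Unset Strict Implicit.
Unset Printing Implicit Defensive.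

Import Order.TTheory.

Local Open Scope classical_set_scope.
Local Open Scope group_scope.

Lemma spowS (S : semigroupType) (x : S) n :
  spow x n.+2 = x * spow x n.+1.
Proof. by rewrite /spow !iteropS iterS. Qed.

Lemma spowD (S : semigroupType) (x : S) m n : (0 < m)%N -> (0 < n)%N ->
  spow x (m + n) = spow x m * spow x n.
Proof.
case: m n => // m [//|n] _ _; elim: m => [|m IH]; first exact: spowS.
by rewrite spowS -mulgA -IH !addSn spowS.
Qed.

Lemma spowSr (S : semigroupType) (x : S) n :
  spow x n.+2 = spow x n.+1 * x.
Proof. by rewrite -addn1 spowD. Qed.

Lemma spow_sqr (S : semigroupType) (x : S) n : (0 < n)%N ->
  spow (x * x) n = spow x n * spow x n.
Proof.
case: n => // n _; elim: n => // n IH.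
have xC : x * spow x n.+1 = spow x n.+1 * x by rewrite -spowS spowSr.
by rewrite spowS IH spowS -!mulgA; congr (x * _); rewrite !mulgA -xC.
Qed.

(** Squaring the base makes the cofactor exist even for the exponent [1],
    although [S] has no unit. *)
Lemma spow_sqr_multl (S : semigroupType) (x : S) n : (0 < n)%N ->
  exists z, spow (x * x) n = z * x.
Proof.
case: n => [//|[|n]] _; first by exists x.
by exists (spow (x * x) n.+1 * x); rewrite spowSr mulgA.
Qed.

Lemma spow_sqr_multr (S : semigroupType) (x : S) n : (0 < n)%N ->
  exists z, spow (x * x) n = x * z.
Proof.
case: n => [//|[|n]] _; first by exists x.
by exists (x * spow (x * x) n.+1); rewrite spowS mulgA.
Qed.

Section OrderedSemigroupTheory.
Context d (S : osemigroupType d).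
Implicit Types a b c p q r s t u v x y : S.

Lemma down_sandwichP u v x :
  down (sandwich u v) x <-> exists s, (x <= u * s * v)%O.
Proof.
split=> [[_ [[s _ <-] xs]]|[s xs]]; first by exists s.
by exists (u * s * v); split=> //; exists s.
Qed.

(** The second factor [c] in [c <= c * (c * r)] can be replaced by the bound
    already known for [c]. *)
Lemma le_spow_mul c r : (c <= c * c * r)%O ->
  forall k, (0 < k)%N -> exists t, (c <= spow c k * t)%O.
Proof.
move=> cr [//|k] _; elim: k => [|k [t ct]].
  by exists (c * r); rewrite mulgA.
exists (t * r); apply: (le_trans cr).
by rewrite spowS -!mulgA; apply: le_mulg2l; rewrite mulgA; apply: le_mulg2r.
Qed.

Lemma le_spow_sandwich a p q : (a <= p * a * q)%O ->
  forall n, (0 < n)%N -> (a <= spow p n * a * spow q n)%O.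
Proof.
move=> apq [//|n] _; elim: n => // n IH; apply: (le_trans apq).
rewrite spowS spowSr !mulgA; apply: le_mulg2r.
by rewrite -!mulgA; apply: le_mulg2l; rewrite mulgA.
Qed.

Lemma ideal_spow (K : ideal S) a m n : (0 < m)%N -> (m < n)%N ->
  spow a m \in (K : set S) -> spow a n \in (K : set S).
Proof.
move=> m0 mn Km; rewrite -(subnKC (ltnW mn)) spowD ?subn_gt0 //.
exact: ideal_memMr.
Qed.

Lemma group_like_idealP (K : ideal S) :
  group_like (ideal_type K) <->
  (forall a b, a \in (K : set S) -> b \in (K : set S) -> exists x y,
    [/\ x \in (K : set S), y \in (K : set S), a <= x * b & a <= b * y]%O).
Proof.
pose sub x Kx : ideal_type K := @exist S (fun z => z \in (K : set S)) x Kx.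
split=> [gK a b Ka Kb|gK a b].
  have [x [y []]] := gK (sub a Ka) (sub b Kb).
  rewrite -!Order.le_val !valM => ax ay.
  exists (val x), (val y).
  by split; [exact: (valP x)|exact: (valP y)|exact: ax|exact: ay].
have [x [y [Kx Ky ax ay]]] := gK _ _ (valP a) (valP b).
by exists (sub x Kx), (sub y Ky); rewrite -!Order.le_val !valM.
Qed.

Lemma nil_group_like_power (K : ideal S) :
  is_nil_extension K -> group_like (ideal_type K) ->
  forall a b, exists n, (0 < n)%N /\
    down (sandwich (spow b n) (spow b n)) (spow a n).
Proof.
move=> /is_nil_extensionP nilK gK a b.
have [m m0 /mem_set Km] := nilK a; have [k k0 /mem_set Kk] := nilK b.
exists (m + k); split; first by rewrite addn_gt0 m0.
have Ka : spow a (m + k) \in (K : set S).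
  by apply: ideal_spow Km; rewrite // -addn1 leq_add2l.
have Kb : spow b (m + k) \in (K : set S).
  by apply: ideal_spow Kk; rewrite // addnC -addn1 leq_add2l.
apply/down_sandwichP.
have [_ [y [_ Ky _ ay]]] := (group_like_idealP K).1 gK _ _ Ka Kb.
have [x [_ [_ _ yx _]]] := (group_like_idealP K).1 gK _ _ Ky Kb.
exists x; apply: (le_trans ay); rewrite -mulgA; exact: le_mulg2l.
Qed.

Definition kernel : set S := [set x | forall b, exists u v, (x <= u * b * v)%O].

Lemma kernel_mull x y : kernel y -> kernel (x * y).
Proof.
move=> Ky b; have [u [v yb]] := Ky b; exists (x * u), v.
by rewrite -!mulgA; apply: le_mulg2l; rewrite mulgA.
Qed.

Lemma kernel_mulr x y : kernel x -> kernel (x * y).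
Proof.
move=> Kx b; have [u [v xb]] := Kx b; exists u, (v * y).
by rewrite mulgA; apply: le_mulg2r.
Qed.

Section PowerCondition.
Hypothesis powS : forall a b, exists n,
  (0 < n)%N /\ down (sandwich (spow b n) (spow b n)) (spow a n).

Lemma power_le_multl a b : exists n z, (0 < n)%N /\ (spow a n <= z * b)%O.
Proof.
have [n [n0 /down_sandwichP[s ale]]] := powS a (b * b).
have [z zb] := spow_sqr_multl b n0.
exists n, (spow (b * b) n * s * z); split=> //.
by rewrite -!mulgA -zb mulgA.
Qed.

Lemma power_le_multr a b : exists n z, (0 < n)%N /\ (spow a n <= b * z)%O.
Proof.
have [n [n0 /down_sandwichP[s ale]]] := powS a (b * b).
have [z bz] := spow_sqr_multr b n0.
exists n, (z * s * spow (b * b) n); split=> //.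
by rewrite !mulgA -bz.
Qed.

Lemma kernel_spow a : exists2 n, (0 < n)%N & kernel (spow a n).
Proof.
have [n [n0 /down_sandwichP[s]]] := powS a (a * a).
rewrite spow_sqr //; set c := spow a n => cs.
exists n => // b.
have /le_spow_mul cpow : (c <= c * c * (s * (c * c)))%O by rewrite !mulgA in cs *.
have [k [k0 /down_sandwichP[r cb]]] := powS c (b * b).
have [z zb] := spow_sqr_multl b k0.
have [t ct] := cpow k k0.
exists z, (r * spow (b * b) k * t); rewrite -zb.
by apply: (le_trans ct); rewrite !mulgA; apply: le_mulg2r.
Qed.

Lemma kernel_neq0 : kernel !=set0.
Proof.
have [x] := @osg_inhabited d S.
by have [n _ Kx] := kernel_spow x; exists (spow x n).
Qed.

Lemma kernel_ideal_mull : setmul setT kernel `<=` kernel.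
Proof. by move=> _ [x _ [y Ky <-]]; apply: kernel_mull. Qed.

Lemma kernel_ideal_mulr : setmul kernel setT `<=` kernel.
Proof. by move=> _ [x Kx [y _ <-]]; apply: kernel_mulr. Qed.

Lemma kernel_down : down kernel = kernel.
Proof.
apply/seteqP; split=> [x [y [Ky xy]] b|x Kx]; last by exists x.
by have [u [v yb]] := Ky b; exists u, v; apply: le_trans yb.
Qed.

Definition kernel_ideal : ideal S :=
  Ideal kernel_neq0 kernel_ideal_mull kernel_ideal_mulr kernel_down.

Lemma kernel_self_sandwich a : kernel a -> exists p q, (a <= p * a * q)%O.
Proof.
move=> Ka; have [u [v]] := Ka (a * a * a).
by rewrite -!mulgA => auv; exists (u * a), (a * v); rewrite -!mulgA.
Qed.

(** The factor [a] kept in the middle of [p ^ n * a * q ^ n] is what places the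
    quotient [x] in the kernel again. *)
Lemma kernel_divl a b : kernel a -> exists2 x, kernel x & (a <= x * b)%O.
Proof.
move=> Ka; have [p [q /le_spow_sandwich apq]] := kernel_self_sandwich Ka.
have [n [z [n0 qz]]] := power_le_multl q b.
exists (spow p n * a * z); first exact/kernel_mulr/kernel_mull.
by apply: (le_trans (apq n n0)); rewrite -(mulgA _ z); apply: le_mulg2l.
Qed.

Lemma kernel_divr a b : kernel a -> exists2 y, kernel y & (a <= b * y)%O.
Proof.
move=> Ka; have [p [q /le_spow_sandwich apq]] := kernel_self_sandwich Ka.
have [n [z [n0 pz]]] := power_le_multr p b.
exists (z * a * spow q n); first exact/kernel_mulr/kernel_mull.
by apply: (le_trans (apq n n0)); rewrite !mulgA; do 2 apply: le_mulg2r.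
Qed.

Lemma kernel_nil_extension : is_nil_extension kernel_ideal.
Proof. exact/is_nil_extensionP/kernel_spow. Qed.

Lemma kernel_group_like : group_like (ideal_type kernel_ideal).
Proof.
apply/group_like_idealP => a b /set_mem Ka _.
have [x Kx ax] := kernel_divl b Ka; have [y Ky ay] := kernel_divr b Ka.
by exists x, y; split=> //; apply/mem_set.
Qed.

End PowerCondition.

End OrderedSemigroupTheory.

Theorem theorem3p3 (d : Order.disp_t) (S : osemigroupType d) :
  nil_extension_of_group_like S <->
  (forall a b : S, exists n : nat,
     (0 < n)%N /\ down (sandwich (spow b n) (spow b n)) (spow a n)).
Proof.
split=> [[K nilK gK]|powS]; first exact: nil_group_like_power nilK gK.
exists (kernel_ideal powS); first exact: kernel_nil_extension.
exact: kernel_group_like.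
Qed.
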